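(* Let $(T_1,\delta_1,X_1),\dots,(T_n,\delta_n,X_n)$ be a right-censored sample, with $T_i\in\mathbb{R}$, $\delta_i\in\{0,1\}$, $X_i\in\mathbb{R}^p$, and let $m_{\hat\theta}:\mathbb{R}^p\to\mathbb{R}$ be a prediction function, where $\hat\theta$ is a statistic of the sample. Let $w_1,\dots,w_n$ be nonnegative real numbers with $\sum_{i=1}^nw_i=1$. Put $\bar T^{(w)}=\sum_{i=1}^nw_iT_i$ and $\bar m^{(w)}_{\hat\theta}=\sum_{i=1}^nw_im_{\hat\theta}(X_i)$, assume $\sum_{i=1}^nw_i\{m_{\hat\theta}(X_i)-\bar m^{(w)}_{\hat\theta}\}^2>0$, and define $$m^{(wc)}_{\hat\theta}(x)=\hat a^{(w)}+\hat b^{(w)}m_{\hat\theta}(x),$$ $$\hat b^{(w)}=\frac{\sum_{i=1}^nw_i(T_i-\bar T^{(w)})\{m_{\hat\theta}(X_i)-\bar m^{(w)}_{\hat\theta}\}}{\sum_{i=1}^nw_i\{m_{\hat\theta}(X_i)-\bar m^{(w)}_{\hat\theta}\}^2},\qquad \hat a^{(w)}=\bar T^{(w)}-\hat b^{(w)}\bar m^{(w)}_{\hat\theta}.$$ (That is, $m^{(wc)}_{\hat\theta}$ is the fitted regression function from the weighted least squares linear regression of $T_1,\dots,T_n$ on $m_{\hat\theta}(X_1),\dots,m_{\hat\theta}(X_n)$ with weight matrix $\mathrm{diag}(w_1,\dots,w_n)$.) Then: (a) (Weighted variance decomposition for $T$) $$\sum_{i=1}^nw_i\{T_i-\bar T^{(w)}\}^2=\sum_{i=1}^nw_i\{m^{(wc)}_{\hat\theta}(X_i)-\bar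 T^{(w)}\}^2+\sum_{i=1}^nw_i\{T_i-m^{(wc)}_{\hat\theta}(X_i)\}^2.$$ (b) (Weighted prediction error decomposition for $T$) $$\sum_{i=1}^nw_i\{T_i-m_{\hat\theta}(X_i)\}^2=\sum_{i=1}^nw_i\{T_i-m^{(wc)}_{\hat\theta}(X_i)\}^2+\sum_{i=1}^nw_i\{m^{(wc)}_{\hat\theta}(X_i)-m_{\hat\theta}(X_i)\}^2.$$
   Context: Here $T=\min\{Y,C\}$ and $\delta=I(Y\le C)$, where $Y$ is the response, $C$ a censoring variable independent of $Y$ given $X$, and the triplets $(T_i,\delta_i,X_i)$ are i.i.d. copies of $(T,\delta,X)$. The function $m_\theta$ is obtained as a functional of a conditional distribution function $F_\theta(\cdot|x)$ in a possibly misspecified regression model $\{F_\theta(y|x):\theta\in\Theta\}$ of $Y$ on $X$. For the statement, $m_{\hat\theta}$ may be any real-valued function, possibly depending on the data. *)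

(* Defs.v *)
From mathcomp Require Import all_boot all_order all_algebra.
From mathcomp Require Import reals.

Set Implicit Arguments.
Unset Strict Implicit.
Unset Printing Implicit Defensive.

Import GRing.Theory Num.Theory.
Local Open Scope ring_scope.

(* No constraint links the fields: every pair (T, delta) arises as
   (min(Y, C), I(Y <= C)) for some real Y and C. *)
Record censored_obs (R : realType) (p : nat) := CensoredObs {
  obs_time : R;
  obs_uncensored : bool;
  obs_covariate : 'rV[R]_p
}.

Section WeightedCalibration.
Variables (R : realType) (n : nat).
Implicit Types (w t z : 'I_n -> R).

(* Not normalized: this is a mean only when the weights sum to 1. *)
Definition wmean w z : R := \sum_(i < n) w i * z i.

Definition wslope w t z : R :=
  (\sum_(i < n) w i * (t i - wmean w t) * (z i - wmean w z))
    / (\sum_(i < n) w i * (z i - wmean w z) ^+ 2).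

Definition wintercept w t z : R := wmean w t - wslope w t z * wmean w z.

Variable p : nat.

Definition wcalibrated w (s : n.-tuple (censored_obs R p)) (m : 'rV[R]_p -> R)
    (x : 'rV[R]_p) : R :=
  let t := fun i => obs_time (tnth s i) in
  let z := fun i => m (obs_covariate (tnth s i)) in
  wintercept w t z + wslope w t z * m x.

End WeightedCalibration.

(* Main.v *)
Require Import Defs.
From mathcomp Require Import all_boot all_order all_algebra.
From mathcomp Require Import reals.
From mathcomp Require Import ring.

Import GRing.Theory Num.Theory.
Local Open Scope ring_scope.

(** The fitted values are the orthogonal projection of the responses, for the
bilinear form <f, g> = \sum_i w i * f i * g i, onto the span of the constants
and of the predictions.  Hence the residual is orthogonal to every affine
function of the prediction [wls_residual_orthogonal].  Both decompositions are
then instances of Pythagoras' theorem [wsum_sqr_pythagoras] for the legs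
response - fit and fit - u: the point u is the constant Tbar in (a) and
the prediction itself in (b), and in either case fit - u is affine in the
prediction. *)

Lemma wsum_sqr_pythagoras (R : comNzRingType) (n : nat) (w t f u : 'I_n -> R) :
  \sum_(i < n) w i * ((t i - f i) * (f i - u i)) = 0 ->
  \sum_(i < n) w i * (t i - u i) ^+ 2 =
    \sum_(i < n) w i * (t i - f i) ^+ 2
    + \sum_(i < n) w i * (f i - u i) ^+ 2.
Proof.
move=> orth.
(* The cross term of the expansion is twice the vanishing sum. *)
transitivity (\sum_(i < n) w i * (t i - f i) ^+ 2
    + \sum_(i < n) w i * (f i - u i) ^+ 2
    + 2 * \sum_(i < n) w i * ((t i - f i) * (f i - u i))); last first.
  by rewrite orth mulr0 addr0.
rewrite mulr_sumr -!big_split /=.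
by apply: eq_bigr => i _; ring.
Qed.

Lemma wsum_centered (R : realType) (n : nat) (w z : 'I_n -> R) :
  \sum_(i < n) w i = 1 -> \sum_(i < n) w i * (z i - wmean w z) = 0.
Proof.
move=> w1.
under eq_bigr => i _ do rewrite mulrBr.
by rewrite sumrB -mulr_suml w1 mul1r subrr.
Qed.

(** These are the normal equations of the weighted regression of t on z.
Writing everything in terms of the centered variables t - tbar and z - zbar,
the residual is (t - tbar) - b (z - zbar) and the test function is
(c + d zbar) + d (z - zbar): the terms of degree one sum to zero by centering,
and those of degree two cancel by the choice of the slope b. *)
Lemma wls_residual_orthogonal (R : realType) (n : nat) (w t z : 'I_n -> R)
    (c d : R) :
  \sum_(i < n) w i = 1 ->
  \sum_(i < n) w i * (z i - wmean w z) ^+ 2 != 0 ->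
  \sum_(i < n) w i *
    ((t i - (wintercept w t z + wslope w t z * z i)) * (c + d * z i)) = 0.
Proof.
move=> w1 var_neq0.
have slopeE : wslope w t z * (\sum_(i < n) w i * (z i - wmean w z) ^+ 2)
    = \sum_(i < n) w i * (t i - wmean w t) * (z i - wmean w z).
  by rewrite /wslope divfK.
move: slopeE (wsum_centered _ _ w t w1) (wsum_centered _ _ w z w1).
(* The means and the slope are themselves sums over the index set; as opaque
constants they make the summand identity below polynomial. *)
rewrite /wintercept; clear var_neq0.
move: (wslope w t z) (wmean w t) (wmean w z) => b tbar zbar slopeE t0 z0.
pose k := c + d * zbar.
transitivity (k * (\sum_(i < n) w i * (t i - tbar))
    - (k * b) * (\sum_(i < n) w i * (z i - zbar))
    + (d * (\sum_(i < n) w i * (t i - tbar) * (z i - zbar))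
       - d * b * (\sum_(i < n) w i * (z i - zbar) ^+ 2))).
  rewrite !mulr_sumr -!sumrB -big_split /=.
  by apply: eq_bigr => i _; rewrite /k; ring.
by rewrite t0 z0 -slopeE; ring.
Qed.

Theorem lemma3p1 (R : realType) (n p : nat)
    (s : n.-tuple (censored_obs R p))
    (Theta : Type) (m : Theta -> 'rV[R]_p -> R)
    (theta_hat : n.-tuple (censored_obs R p) -> Theta)
    (w : 'I_n -> R) :
  let T := fun i : 'I_n => obs_time (tnth s i) in
  let X := fun i : 'I_n => obs_covariate (tnth s i) in
  let mhat := m (theta_hat s) in
  let Tbar := wmean w T in
  let mbar := wmean w (fun i => mhat (X i)) in
  let mwc := wcalibrated w s mhat in
  (forall i : 'I_n, 0 <= w i) ->
  \sum_(i < n) w i = 1 ->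
  0 < \sum_(i < n) w i * (mhat (X i) - mbar) ^+ 2 ->
  \sum_(i < n) w i * (T i - Tbar) ^+ 2 =
    \sum_(i < n) w i * (mwc (X i) - Tbar) ^+ 2
    + \sum_(i < n) w i * (T i - mwc (X i)) ^+ 2
  /\
  \sum_(i < n) w i * (T i - mhat (X i)) ^+ 2 =
    \sum_(i < n) w i * (T i - mwc (X i)) ^+ 2
    + \sum_(i < n) w i * (mwc (X i) - mhat (X i)) ^+ 2.
Proof.
move=> T X mhat Tbar mbar mwc _ w1 var_gt0.
pose z i := mhat (X i).
pose a := wintercept w T z; pose b := wslope w T z.
have orth c d :
    \sum_(i < n) w i * ((T i - mwc (X i)) * (c + d * mhat (X i))) = 0.
  exact: (wls_residual_orthogonal _ _ w T z c d w1 (lt0r_neq0 var_gt0)).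
have mwcE i : mwc (X i) = a + b * mhat (X i) by [].
split.
- rewrite addrC; apply: wsum_sqr_pythagoras.
  rewrite -[RHS](orth (a - Tbar) b); apply: eq_bigr => i _.
  by rewrite mwcE; ring.
- apply: wsum_sqr_pythagoras.
  rewrite -[RHS](orth a (b - 1)); apply: eq_bigr => i _.
  by rewrite mwcE; ring.
Qed.
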